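(* Assume the generalized continuum hypothesis ($2^{\omega_\alpha}=\omega_{\alpha+1}$ for every ordinal $\alpha$). Then for every pca $\mathcal{A}$ there exists a cardinal $\kappa$ with $\kappa^{<\kappa}=\kappa$ such that $\mathcal{A}$ weakly embeds into $\mathcal{K}_2^\kappa$, i.e.\ there is an injection $f:\mathcal{A}\to\kappa^\kappa$ such that for all $a,b\in\mathcal{A}$, if $ab$ is defined in $\mathcal{A}$ then $f(a)\cdot f(b)$ is defined in $\mathcal{K}_2^\kappa$ and equals $f(ab)$.
   Context: A pca (partial combinatory algebra) is a set with more than one element and a partial binary application $(a,b)\mapsto ab$ (left-associating) admitting combinators $k,s$ with $ka$ defined and $kab=a$, $sab$ defined and $sabc\simeq ac(bc)$ for all $a,b,c$. Definition of $\mathcal{K}_2^\kappa$ (for an infinite cardinal $\kappa$ with $\kappa^{<\kappa}=\kappa$): let $\kappa^{<\kappa}=\bigcup_{\lambda<\kappa}\kappa^\lambda$ and fix a bijection $\langle\cdot\rangle:\kappa^{<\kappa}\to\kappa$. For $n\in\kappa$ and $\sigma\in\kappa^{<\kappa}\cup\kappa^\kappa$, $n^\frown\sigma$ is the function with $(n^\frown\sigma)(0)=n$, $(n^\frown\sigma)(m+1)=\sigma(m)$ for $m<\omega$, $(n^\frown\sigma)(m)=\sigma(m)$ for $\omega\le m$ in the domain. $\beta\restriction m$ is the restriction of $\beta$ to ordinals $<m$. For $\alpha\in\kappa^\kappa$, $F_\alpha(\beta)=n$ if there is $m\in\kappa$ with $\alpha(\langle\beta\restriction m\rangle)=n+1$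 and $\alpha(\langle\beta\restriction k\rangle)$ is $0$ or a limit ordinal for all $k<m$; otherwise undefined. $\mathcal{K}_2^\kappa$ is the pca on $\kappa^\kappa$ with $(\alpha\cdot\beta)(n)=F_\alpha(n^\frown\beta)$ for $n\in\kappa$, $\alpha\cdot\beta$ being defined iff this is defined for all $n\in\kappa$. *)

(* Defs.v *)
From mathcomp Require Import all_boot.
From mathcomp Require Import boolp classical_sets functions cardinality.
From mathcomp Require Import wochoice.

Set Implicit Arguments.
Unset Strict Implicit.
Unset Printing Implicit Defensive.

Local Open Scope classical_set_scope.
Local Open Scope card_scope.

(* An ordinal is represented by a well-ordered type K, up to isomorphism. The
   elements of K stand for the ordinals smaller than K: x : K is identified with
   the initial segment [seg x], and [olt x y] is x < y as ordinals. *)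
Record ordinalType := OrdinalType {
  osort :> Type;
  ole : rel osort;
  ole_wo : well_order ole }.
Arguments ole {_}.

Section Ordinals.
Variable K : ordinalType.
Implicit Types x y n : K.

Definition olt x y : bool := ~~ ole y x.

Definition seg x : set K := [set y | olt y x].

Definition is_zero x : Prop := forall y, ole x y.

(* [is_succ n x] is x = n + 1; such an x need not exist when K is a successor. *)
Definition is_succ n x : Prop := olt n x /\ forall y, olt n y -> ole x y.

Definition is_limit x : Prop := ~ is_zero x /\ ~ exists n, is_succ n x.

Definition below_omega x : Prop := finite_set (seg x).

(* A cardinal is an ordinal that is not equinumerous to any smaller one. The
   same notion is given for the ordinal K and for the ordinals below K. *)
Definition is_cardinal : Prop := forall x, seg x #!= [set: K].

Definition is_cardinal_at x : Prop := forall y, olt y x -> seg y #!= seg x.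

End Ordinals.

Lemma option_well_order (K : ordinalType) :
  well_order (fun x y : option K =>
    match x, y with
    | _, None => true
    | None, Some _ => false
    | Some a, Some b => ole a b
    end).
Proof.
move=> A [x0 Ax0].
have [[a Aa]|noA] := pselect (exists a : K, Some a \in A).
  pose B : {pred K} := fun b : K => Some b \in A.
  have neB : nonempty B by exists a.
  have [z [[Bz zmin] zuniq]] := ole_wo neB.
  exists (Some z); split.
    by split=> [//|[b|] //= Ab]; exact: zmin.
  move=> [w|] [Aw wmin]; last by have := wmin _ Bz.
  congr Some; apply: zuniq; split=> // b Bb.
  exact: (wmin (Some b)).
have AN x : x \in A -> x = None.
  by case: x => // a Aa; case: noA; exists a.
exists None; split; first by split; [rewrite -(AN _ Ax0)|move=> x /AN ->].
by move=> x [/AN ->].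
Qed.

(* The ordinal a + 1, with [None] as its greatest element. *)
Definition osucc (a : ordinalType) : ordinalType :=
  OrdinalType (@option_well_order a).

(* K = omega_a: K is an infinite cardinal, and the infinite cardinals below K
   are enumerated in increasing order by a. *)
Definition is_aleph (a K : ordinalType) : Prop :=
  [/\ is_cardinal K, infinite_set [set: K] &
      exists f : a -> K, (forall i j, ole (f i) (f j) = ole i j) /\
        range f = [set x | is_cardinal_at x /\ infinite_set (seg x)]].

Definition GCH : Prop := forall a K L : ordinalType,
  is_aleph a K -> is_aleph (osucc a) L -> [set: K -> bool] #= [set: L].

(* The value characterized by P, when there is one; P is only ever used where
   it has at most one solution. *)
Definition oiota (T : Type) (P : T -> Prop) : option T :=
  if pselect (exists x, P x) is left h then Some (projT1 (cid h)) else None.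

(* Sets with a partial binary application, [None] meaning undefined. *)
Record partialApp := PartialApp {
  pa_sort :> Type;
  pa_app : pa_sort -> pa_sort -> option pa_sort }.
Arguments pa_app {_}.

(* Application of possibly undefined terms; equality in [option A] is then
   Kleene equality of terms. *)
Definition tapp (A : partialApp) (x y : option A) : option A :=
  obind (fun a => obind (pa_app a) y) x.

Declare Scope pca_scope.
Delimit Scope pca_scope with pca.
Notation "x \* y" := (tapp x y)
  (at level 40, left associativity) : pca_scope.
Notation "^ a" := (Some a) (at level 9, a at level 8, format "^ a") : pca_scope.

Definition is_pca (A : partialApp) : Prop :=
  (exists a b : A, a <> b) /\
  (exists k s : A, forall a b c : A,
    [/\ (^k \* ^a)%pca : bool, (^k \* ^a \* ^b = ^a)%pca,
        (^s \* ^a \* ^b)%pca : bool &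
        (^s \* ^a \* ^b \* ^c = (^a \* ^c) \* (^b \* ^c))%pca]).

Definition weak_embedding (A B : partialApp) (f : A -> B) : Prop :=
  injective f /\
  forall a b c : A, pa_app a b = Some c -> pa_app (f a) (f b) = Some (f c).

Section K2.
Variable K : ordinalType.

(* K^{<K}: a length l < K together with a function from l to K. *)
Definition ltseq : Type := {l : K & {x : K | olt x l} -> K}.

Definition restr (beta : K -> K) (m : K) : ltseq :=
  existT (fun l : K => {x : K | olt x l} -> K) m (fun x => beta (sval x)).

(* The last branch is reached exactly when x is not below omega. *)
Definition ocons (n : K) (beta : K -> K) (x : K) : K :=
  if pselect (is_zero x) then n
  else if pselect (exists m, below_omega m /\ is_succ m x) is left h
  then beta (projT1 (cid h))
  else beta x.

Variable code : ltseq -> K.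

Definition F (alpha beta : K -> K) : option K :=
  oiota (fun n => exists m,
    is_succ n (alpha (code (restr beta m))) /\
    forall k, olt k m -> is_zero (alpha (code (restr beta k))) \/
                         is_limit (alpha (code (restr beta k)))).

Definition K2 : partialApp :=
  @PartialApp (K -> K) (fun alpha beta =>
    oiota (fun gamma : K -> K =>
      forall n, F alpha (ocons n beta) = Some (gamma n))).

End K2.

(* Main.v *)
Require Import Defs.
From HB Require Import structures.
From mathcomp Require Import all_boot.
From mathcomp Require Import boolp classical_sets functions cardinality.
From mathcomp Require Import wochoice.

Local Open Scope classical_set_scope.
Local Open Scope card_scope.

Set Implicit Arguments.
Unset Strict Implicit.
Unset Printing Implicit Defensive.

(* Choose for every a in A its own ordinal mark(a) < kappa that is not a
   successor. Let e be the code of the empty sequence. Define f(a)(x), for all a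
   at once, by recursion on x: if x codes an initial segment of some n^beta with
   n < x and beta(e) = mark(b) visible in that segment, and ab is defined, then
   f(a)(x) = f(ab)(n) + 1; otherwise f(a)(x) = mark(a). In particular
   f(b)(e) = mark(b), so all sufficiently long initial segments of n^f(b) qualify
   as soon as their code exceeds n, and by injectivity of the coding one of them
   has such a code. Up to that point F_{f(a)} reads mark(a), which it skips.

   For kappa, let T be the set of maps from nat to A, and kappa = |T|^+. By GCH,
   kappa = 2^|T|, and kappa^{<kappa} = kappa because |T x T| = |T|. Both |T| and
   |T|^+ are found as initial segments of the ordinal omega * (T + 2^T + 1),
   where the multiples of omega below omega * T serve as marks. *)

(** * Cardinal inequalities *)

Lemma card_leTP (T U : Type) (A : set T) (u : U) :
  A #<= [set: U] <->
  exists f : T -> U, forall x y, A x -> A y -> f x = f y -> x = y.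
Proof.
(* The point [u] makes [U] pointed, so that an injection on [A] extends to a total function. *)
pose V := HB.pack_for pointedType {classic U} (isPointed.Build {classic U} u).
split=> [/(@pcard_injP T V)[f fI]|[f fI]].
  by exists f => x y Ax Ay; apply: fI; exact: mem_set.
by apply/(@pcard_injP T V); exists f => x y /set_mem Ax /set_mem Ay; exact: fI.
Qed.

Lemma card_le_inj (T U : Type) (A : set T) (B : set U) (f : T -> U) :
  (forall x, A x -> B (f x)) ->
  (forall x y, A x -> A y -> f x = f y -> x = y) -> A #<= B.
Proof.
move=> fAB fI; have [|g] := (@injfunPex T U A B).2; last exact: inj_card_le g.
by exists f => // x y /set_mem Ax /set_mem Ay; exact: fI.
Qed.

Lemma card_leT_inj (T U : Type) (f : T -> U) :
  injective f -> [set: T] #<= [set: U].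
Proof. by move=> fI; apply: (card_le_inj (f := f)) => // x y _ _; exact: fI. Qed.

(** Along an injection, a subset is recovered as the preimage of its direct image. *)
Lemma card_leT_pow (T U : Type) (u : U) :
  [set: T] #<= [set: U] -> [set: T -> bool] #<= [set: U -> bool].
Proof.
move=> /(card_leTP _ u)[g gI].
pose G (f : T -> bool) v := `[< exists x, g x = v /\ f x >].
apply: (@card_leT_inj _ _ G) => f f' /funeqP /= ff'; apply/funext => x.
move: (ff' (g x)); rewrite /G.
have gE (h : T -> bool) : `[< exists y, g y = g x /\ h y >] = h x.
  apply/asboolP/idP => [[y [/(gI _ _ I I)-> //]]|hx]; by exists x.
by rewrite !gE.
Qed.

(** Cantor's diagonal: [d] collects the codes [g f] of those sets [f] that do not contain [g f]. *)
Lemma not_card_le_pow (T : Type) (t : T) : ~ ([set: T -> bool] #<= [set: T]).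
Proof.
move=> /(card_leTP _ t)[g gI].
pose d x := `[< exists f : T -> bool, g f = x /\ ~~ f x >].
have: d (g d) = ~~ d (g d).
  apply/asboolP/idP => [[f [/(gI _ _ I I)-> //]]|nd]; by exists d.
by case: (d _).
Qed.

(** * Ordinals *)

Section OrdinalTheory.
Variable K : ordinalType.
Implicit Types x y z : K.

Lemma ole_min (P : K -> Prop) :
  (exists x, P x) -> exists x, P x /\ forall y, P y -> ole x y.
Proof.
move=> [x0 Px0]; have [|z [[Pz zmin] _]] := @ole_wo K (fun x => `[< P x >]).
  by exists x0; exact/asboolP.
by exists z; split=> [|y Py]; [exact/asboolP|apply: zmin; exact/asboolP].
Qed.

Lemma ole_total x y : ole x y || ole y x.
Proof.
have [|z [[->|->] zmin]] := @ole_min (fun z => z = x \/ z = y).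
- by exists x; left.
- by rewrite zmin //; right.
- by rewrite (zmin x) ?orbT //; left.
Qed.

Lemma ole_refl x : ole x x.
Proof. by have := ole_total x x; rewrite orbb. Qed.

(** Both points are least in the pair, and minima are unique. Transitivity likewise comes from the
    minimum of a triple. *)
Lemma ole_anti x y : ole x y -> ole y x -> x = y.
Proof.
move=> xy yx.
have [|z [_ zuniq]] := @ole_wo K (fun z => `[< z = x \/ z = y >]).
  by exists x; apply/asboolP; left.
rewrite -(zuniq x); last first.
  by split=> [|w /asboolP[]->]; [apply/asboolP; left|exact: ole_refl|].
apply: zuniq.
by split=> [|w /asboolP[]->]; [apply/asboolP; right| |exact: ole_refl].
Qed.

Lemma ole_trans x y z : ole x y -> ole y z -> ole x z.
Proof.
move=> xy yz.
have [|w [[->|[->|->]] wmin]] := @ole_min (fun w => w = x \/ w = y \/ w = z).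
- by exists x; left.
- by apply: wmin; right; right.
- by rewrite (@ole_anti x y xy) //; apply: wmin; left.
- by rewrite -(@ole_anti y z yz) //; apply: wmin; right; left.
Qed.

Lemma oltW x y : olt x y -> ole x y.
Proof. by rewrite /olt; have := ole_total x y; case: ole => //= ->. Qed.

Lemma olt_irr x : olt x x = false.
Proof. by rewrite /olt ole_refl. Qed.

Lemma ole_eqVlt x y : ole x y -> x = y \/ olt x y.
Proof.
move=> xy; case yx: (ole y x); [left|right; by rewrite /olt yx].
exact: ole_anti.
Qed.

Lemma ole_olt_trans x y z : ole x y -> olt y z -> olt x z.
Proof. by move=> xy; apply: contra => zx; exact: ole_trans xy. Qed.

Lemma olt_ole_trans x y z : olt x y -> ole y z -> olt x z.
Proof. by move=> + yz; apply: contra => zx; exact: ole_trans zx. Qed.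

Lemma olt_trans x y z : olt x y -> olt y z -> olt x z.
Proof. by move=> /oltW; exact: ole_olt_trans. Qed.

Lemma olt_trich x y : [\/ olt x y, x = y | olt y x].
Proof.
case xy: (ole x y); last by constructor 3; rewrite /olt xy.
by have [->|] := ole_eqVlt xy; [constructor 2|constructor 1].
Qed.

Lemma olt_wf : well_founded (fun x y => olt x y).
Proof.
move=> x; apply: contrapT => nx.
have [|z [nz zmin]] := @ole_min (fun z => ~ Acc (fun x y => olt x y) z).
  by exists x.
apply: nz; constructor => y yz; apply: contrapT => /zmin.
by move: yz; rewrite /olt => /negP.
Qed.

(** [G] receives a total function, equal to the default [d] at and above [x], so that recursive
    calls carry no proof of [olt y x]. *)
Lemma wf_rec (B : Type) (d : B) (G : K -> (K -> B) -> B) :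
  exists h, forall x, h x = G x (fun y => if olt y x then h y else d).
Proof.
pose G' x (r : forall y, olt y x -> B) :=
  G x (fun y => if pselect (olt y x) is left yx then r y yx else d).
exists (Fix olt_wf (fun=> B) G') => x; rewrite Fix_eq; last first.
  move=> {}x r r' rr'; rewrite /G'; congr G; apply/funext => y.
  by case: pselect.
rewrite {1}/G'; congr G; apply/funext => y.
by case: pselect => [->|/negP/negbTE->].
Qed.

Lemma seg_sub x y : ole x y -> seg x `<=` seg y.
Proof. by move=> xy z /= zx; exact: olt_ole_trans xy. Qed.

Lemma is_succ_inj n n' x : is_succ n x -> is_succ n' x -> n = n'.
Proof.
move=> [nx nmin] [nx' nmin'].
have [nn'|//|nn'] := olt_trich n n'.
  by move: nx'; rewrite /olt nmin.
by move: nx; rewrite /olt nmin'.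
Qed.

Lemma ex_succ x : (exists y, olt x y) -> exists y, is_succ x y.
Proof. by move=> /ole_min[y []]; exists y. Qed.

Lemma is_succ_not_limit n x : is_succ n x -> ~ (is_zero x \/ is_limit x).
Proof.
move=> [nx nmin] [/(_ n)|[_ nl]]; first by move: nx; rewrite /olt => /negP.
by apply: nl; exists n.
Qed.

Lemma not_succ x : (forall n, ~ is_succ n x) -> is_zero x \/ is_limit x.
Proof.
move=> ns; case: (pselect (is_zero x)) => [|nz]; [by left|right].
by split=> // -[n /ns].
Qed.

End OrdinalTheory.

(** * A weak embedding into K2 *)

Lemma oiota_eq (T : Type) (P : T -> Prop) x :
  P x -> (forall y, P y -> y = x) -> oiota P = Some x.
Proof.
move=> Px Puniq; rewrite /oiota; case: pselect => [h|[]]; last by exists x.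
by congr Some; apply: Puniq; exact: projT2 (cid h).
Qed.

Section Sequences.
Variable K : ordinalType.

(** Reading a sequence as a partial function on [K] hides its dependent domain. *)
Definition lget (s : ltseq K) (x : K) : option K :=
  if pselect (olt x (tag s)) is left xs then Some (tagged s (exist _ x xs))
  else None.

Lemma lget_restr beta m x :
  lget (restr beta m) x = if olt x m then Some (beta x) else None.
Proof. by rewrite /lget /=; case: pselect => [->|/negP/negbTE->]. Qed.

Lemma lget_SomeP s x : (exists y, lget s x = Some y) <-> olt x (tag s).
Proof.
rewrite /lget; case: pselect => xs; last by split=> // -[].
by split=> // _; eexists.
Qed.

Lemma lget_inj s s' :
  tag s = tag s' -> (forall x, lget s x = lget s' x) -> s = s'.
Proof.
case: s s' => l s [l' s'] /= ll'; case: l' / ll' s' => s' ss'.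
congr existT; apply/funext => -[x xl]; have := ss' x; rewrite /lget /=.
by case: pselect => // xl'; rewrite (Prop_irrelevance xl' xl) => -[].
Qed.

Lemma restr_inj (beta : K -> K) : injective (restr beta).
Proof. by move=> m m' /(congr1 (@tag _ _)). Qed.

Lemma below_omega_succ (x y : K) : below_omega x -> is_succ x y -> below_omega y.
Proof.
move=> xfin [xy ymin]; rewrite /below_omega.
apply: (@sub_finite_set _ _ (seg x `|` [set x])); last first.
  by rewrite finite_setU; split=> //; exact: finite_set1.
move=> z /= zy; have [zx|->|xz] := olt_trich z x; [by left|by right|].
by have := ole_olt_trans (ymin _ xz) zy; rewrite olt_irr.
Qed.

Lemma ocons_zero n beta z : is_zero z -> @ocons K n beta z = n.
Proof. by move=> z0; rewrite /ocons; case: pselect. Qed.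

(** Prepending shifts the finite positions by one and fixes the infinite ones, so [p] is x + 1 or
    [x]. *)
Lemma ex_ocons_pos (x : K) :
  (exists y, olt x y) ->
  exists p, ~ is_zero p /\ forall n beta, @ocons K n beta p = beta x.
Proof.
move=> /ex_succ[y xy]; have [xfin|xinf] := pselect (below_omega x).
  exists y.
  have ynz : ~ is_zero y by move=> /(_ x); case: xy; rewrite /olt => /negP.
  split=> // n beta; rewrite /ocons.
  case: (pselect (is_zero y)) => [/ynz//|ynz'].
  case: pselect => [h|[]]; last by exists x.
  by congr beta; have [_ my] := projT2 (cid h); exact: is_succ_inj my xy.
have xnz : ~ is_zero x.
  move=> xz; apply: xinf; rewrite /below_omega (_ : seg x = set0) //.
  by rewrite -subset0 => z; rewrite /seg /= /olt xz.
exists x; split=> // n beta.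
rewrite /ocons; case: (pselect (is_zero x)) => [/xnz//|?].
case: pselect => // -[m [mfin mx]].
by case: xinf; exact: below_omega_succ mfin mx.
Qed.

End Sequences.

Section Embedding.
Variables (K : ordinalType) (code : ltseq K -> K) (A : partialApp).
Variable mark : A -> K.
Hypotheses (codeB : bijective code) (mark_inj : injective mark).
Hypothesis mark_not_succ : forall a n, ~ is_succ n (mark a).
(** Meant for [g m] the code of the restriction of a function to [m]: some initial segment reaches
    past position [p] and has a code above [n]. With [g] the identity, [K] has no greatest
    element. *)
Hypothesis unbounded : forall g : K -> K, injective g ->
  forall p n, exists m, olt p m /\ olt n (g m).

Lemma ex_weak_embedding_K2 (z : K) : exists f : A -> K2 code, weak_embedding f.
Proof.
have [decode codeK decodeK] := codeB.
have nomax (x : K) : exists y, olt x y.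
  by have [y []] := unbounded (@inj_id K) x x; exists y.
have [suc sucP] := choice (fun x => ex_succ (nomax x)).
have [z0 [_ z0P]] := @ole_min K (fun=> True) (ex_intro _ z I).
(* As [z0] is the ordinal 0, [e] codes the empty sequence; position [p] of n^beta shows beta(e). *)
pose e := code (restr id z0).
have [p [pnz pP]] := ex_ocons_pos (nomax e).
have z0p : olt z0 p.
  by rewrite /olt; apply/negP => p0; apply: pnz => y; exact: ole_trans p0 (z0P y I).
pose trig a x (nc : K * A) := [/\ lget (decode x) z0 = Some nc.1, olt nc.1 x &
  exists b, lget (decode x) p = Some (mark b) /\ pa_app a b = Some nc.2].
have trig_inj a x nc nc' : trig a x nc -> trig a x nc' -> nc = nc'.
  case: nc nc' => n c [n' c'] [/= z0n _ [b [pb ab]]].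
  move=> [/= z0n' _ [b' [pb' ab']]]; move: z0n'; rewrite z0n => -[<-].
  by move: pb' ab'; rewrite pb => -[/mark_inj <-]; rewrite ab => -[<-].
(* The call [h n c] concerns another element [c], so the recursion runs over functions [A -> K]. As
   [trig] forces n < x, the default is never read. *)
pose G x (h : K -> A -> K) a :=
  if oiota (trig a x) is Some (n, c) then suc (h n c) else mark a.
have [h hP] := wf_rec (fun=> z) G.
have h_trig a x n c : trig a x (n, c) -> h x a = suc (h n c).
  move=> t; rewrite hP /G (oiota_eq t); first by case: t => /= _ -> _.
  by move=> nc t'; exact: trig_inj t' t.
have h_mark a x : (forall nc, ~ trig a x nc) -> h x a = mark a.
  move=> nt; rewrite hP /G /oiota; case: pselect => //= -[nc /nt] //.
(* The empty sequence has no entry at 0, so nothing is triggered at [e]. Injectivity of the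
   embedding follows as well. *)
have he d : h e d = mark d.
  by apply: h_mark => nc [+ _ _]; rewrite codeK lget_restr olt_irr.
exists (fun a x => h x a); split=> [a a' /(congr1 (@^~ e))|a b c abc].
  by rewrite /= !he => /mark_inj.
have FE n : F code (h^~ a) (ocons n (h^~ b)) = Some (h n c).
  set beta := ocons n _.
  have betap : beta p = mark b by rewrite /beta pP.
  have beta0 : beta z0 = n by apply: ocons_zero => y; exact: z0P.
  (* Along [beta] only the pair (n, c) can be triggered, exactly at the prefixes that contain [p]
     and have a code above [n]. *)
  have trigP m nc : trig a (code (restr beta m)) nc <->
     nc = (n, c) /\ olt p m /\ olt n (code (restr beta m)).
    rewrite /trig codeK !lget_restr; case: nc => n' c' /=.
    split=> [[+ n'm [b' []]]|[[-> ->] [pm nm]]]; last first.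
      by rewrite pm (olt_trans z0p pm) betap beta0; split=> //; exists b.
    case: ifP => // _ [nn']; case: ifP => // pm [bb'].
    move: bb' n'm; rewrite -nn' beta0 betap => /mark_inj <-.
    by rewrite abc => nm [->].
  have codeI := inj_comp (can_inj codeK) (@restr_inj K beta).
  (* At the least such [m] a successor is read; before it, only the mark of [a]. *)
  have [m [[pm nm] mmin]] := ole_min (unbounded codeI p n).
  have hm : is_succ (h n c) (h (code (restr beta m)) a).
    by rewrite (h_trig a (code _) n c); [exact: sucP|exact/trigP].
  have hk k : olt k m ->
     is_zero (h (code (restr beta k)) a) \/ is_limit (h (code (restr beta k)) a).
    move=> km; apply: not_succ => v; rewrite h_mark; first exact: mark_not_succ.
    by move=> nc /trigP[_ kP]; move: km; rewrite /olt mmin.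
  apply: oiota_eq; first by exists m.
  (* Of two distinct stopping points, the smaller would carry a successor that the search up to the
     larger has to skip. *)
  move=> v [m' [vm' m'min]]; have [mm'|mm'|m'm] := olt_trich m m'.
  - by have := is_succ_not_limit hm (m'min _ mm').
  - by apply: is_succ_inj vm' _; rewrite -mm'.
  - by have := is_succ_not_limit vm' (hk _ m'm).
apply: oiota_eq => [//|gamma gammaP]; apply/funext => n.
by have := gammaP n; rewrite FE => -[].
Qed.

End Embedding.

(** * A cardinal equinumerous to a power set *)

Lemma well_orderI (T : Type) (R : rel T) :
  antisymmetric R ->
  (forall P : T -> Prop, (exists x, P x) ->
     exists x, P x /\ forall y, P y -> R x y) ->
  well_order R.
Proof.
move=> Ra Rmin; apply: antisymmetric_well_order => // A /(Rmin (fun x => x \in A)).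
by move=> [x [Ax xmin]]; exists x; split.
Qed.

(** * Ordinal sums, multiples of omega, suborders and initial segments *)

Section Sum.
Variables a b : ordinalType.

Definition osum_le (x y : a + b) : bool :=
  match x, y with
  | inl u, inl v => ole u v
  | inl _, inr _ => true
  | inr _, inl _ => false
  | inr u, inr v => ole u v
  end.

Lemma osum_well_order : well_order osum_le.
Proof.
apply: well_orderI => [|P [x0 Px0]].
  by move=> [u|u] [v|v] //= /andP[uv vu]; congr (_ _); exact: ole_anti.
have [/ole_min[u [Pu umin]]|nl] := pselect (exists u, P (inl u)).
  by exists (inl u); split=> // -[v|v] //; exact: umin.
have [|u [Pu umin]] := @ole_min b (fun u => P (inr u)).
  by case: x0 Px0 => [u Pu|u Pu]; [case: nl|]; exists u.
exists (inr u); split=> // -[v Pv|v]; last exact: umin.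
by case: nl; exists v.
Qed.

Definition osum : ordinalType := OrdinalType osum_well_order.

End Sum.

Section OmegaMultiple.
Variable a : ordinalType.

Definition omegaM_le (x y : a * nat) : bool :=
  olt x.1 y.1 || ole x.1 y.1 && (x.2 <= y.2).

Lemma omegaM_well_order : well_order omegaM_le.
Proof.
apply: well_orderI => [|P [[u0 n0] Pun]].
  move=> [u n] [v k]; rewrite /omegaM_le /=.
  move=> /andP[/orP[uv|/andP[uv nk]] /orP[vu|/andP[vu kn]]].
  - by have := olt_trans uv vu; rewrite olt_irr.
  - by move: uv; rewrite /olt vu.
  - by move: vu; rewrite /olt uv.
  - by rewrite (ole_anti uv vu); congr pair; apply/eqP; rewrite eqn_leq nk.
have [|u [[n Pu] umin]] := @ole_min a (fun u => exists n, P (u, n)).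
  by exists u0, n0.
have exn : exists n, `[< P (u, n) >] by exists n; exact/asboolP.
case: (ex_minnP exn) => k /asboolP Pk kmin.
exists (u, k); split=> // -[v j] Pv; rewrite /omegaM_le /=.
have [|uv|->] := ole_eqVlt (umin v _); first by exists j.
  by move: Pv; rewrite -uv => Pv; rewrite ole_refl kmin ?orbT //; exact/asboolP.
by [].
Qed.

(* The ordinal omega * a, that is, a copies of omega in a row. *)
Definition omegaM : ordinalType := OrdinalType omegaM_well_order.

Lemma omegaM_not_succ (u : a) (x : omegaM) : ~ is_succ x ((u, 0) : omegaM).
Proof.
case: x => v n [vu vmin].
have : ole ((u, 0) : omegaM) ((v, n.+1) : omegaM).
  by apply: vmin; rewrite /olt /= /omegaM_le /= olt_irr ole_refl ltnn.
(* As 0 is the least number, comparing (u, 0) with (v, n + 1) or with (v, n) computes to the same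
   Boolean, which [vu] refutes. *)
exact/negP.
Qed.

End OmegaMultiple.

Section Suborder.
Variables (K : ordinalType) (P : pred K).

Lemma osub_well_order : well_order (fun x y : {x | P x} => ole (sval x) (sval y)).
Proof.
apply: well_orderI => [x y /andP[xy yx]|Q [x0 Qx0]].
  exact: val_inj (ole_anti xy yx).
have [|x [[Px Qx] xmin]] := @ole_min K (fun x => exists Px, Q (exist _ x Px)).
  by case: x0 Qx0 => x Px Qx; exists x, Px.
exists (exist _ x Px); split=> // -[y Py] Qy; apply: xmin => /=; by exists Py.
Qed.

Definition osub : ordinalType := OrdinalType osub_well_order.

Lemma card_osub (Q : set K) : Q `<=` P -> [set x : osub | Q (sval x)] #= Q.
Proof.
move=> QP; rewrite card_eq_le; apply/andP; split.
  by apply: (card_le_inj (f := sval)) => [//|x y _ _]; exact: val_inj.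
apply: (card_le_trans _ (card_image_le sval _)); apply: subset_card_le => x Qx.
by exists (exist _ x (QP x Qx)).
Qed.

End Suborder.

Definition oseg (K : ordinalType) (x : K) : ordinalType := osub (fun y => olt y x).

Section InitialSegments.
Variables (K : ordinalType) (x : K).

Lemma card_setT_oseg : [set: oseg x] #= seg x.
Proof.
have := @card_osub K (fun y => olt y x) (seg x) (fun _ h => h).
by congr (_ #= _); apply/seteqP; split=> // -[].
Qed.

Lemma card_seg_oseg (y : oseg x) : seg y #= seg (sval y).
Proof. by apply: card_osub => z /= zy; exact: olt_trans zy (svalP y). Qed.

Lemma is_cardinal_at_oseg (y : oseg x) :
  is_cardinal_at y <-> is_cardinal_at (sval y).
Proof.
split=> cy z zy.
  pose z' : oseg x := exist _ z (olt_trans zy (svalP y)).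
  have := cy z' zy; apply: contra => zE.
  by rewrite (card_eql (card_seg_oseg z')) (card_eqr (card_seg_oseg y)).
have := cy (sval z) zy; apply: contra.
by rewrite (card_eql (card_seg_oseg z)) (card_eqr (card_seg_oseg y)).
Qed.

Lemma is_cardinal_oseg : is_cardinal_at x -> is_cardinal (oseg x).
Proof.
move=> cx z; have := cx (sval z) (svalP z); apply: contra.
by rewrite (card_eql (card_seg_oseg z)) (card_eqr card_setT_oseg).
Qed.

End InitialSegments.

Lemma card_seg_oseg_eq (K : ordinalType) (l m : K) (x : oseg l) (y : oseg m) :
  sval x = sval y -> seg x #= seg y.
Proof.
move=> xy; apply: card_eq_trans (card_seg_oseg x) _.
by rewrite xy card_eq_sym card_seg_oseg.
Qed.

Lemma infinite_card_eq (T U : Type) (A : set T) (B : set U) :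
  A #= B -> infinite_set A -> infinite_set B.
Proof.
rewrite card_eq_le => /andP[AB _] Ainf Bfin; apply: Ainf.
exact: card_le_finite AB Bfin.
Qed.

(** [K] is the successor cardinal of |T|. If [a] is the order type of the infinite cardinals below
    |T|, then |T| and [K] are the alephs of index a and a + 1, the form in which [GCH] applies. *)
Lemma GCH_ex_cardinal (T : Type) (t0 : T) :
  GCH -> infinite_set [set: T] -> [set: T * nat] #<= [set: T] ->
  exists K : ordinalType,
    [/\ forall x : K, seg x #<= [set: T], [set: T -> bool] #= [set: K] &
        exists mark : T -> K,
          injective mark /\ forall t n, ~ is_succ n (mark t)].
Proof.
move=> gch Tinf /(card_leTP _ t0)[j jI].
have [R1 wo1] := well_ordering_principle {classic T}.
have [R2 wo2] := well_ordering_principle {classic (T -> bool)}.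
pose U1 := @OrdinalType T R1 wo1.
pose U2 := @OrdinalType (T -> bool) R2 wo2.
pose W := omegaM (osucc (osum U1 U2)).
pose mk t : W := (Some (inl t), 0).
(* The point [x0] starts the block of 2^T. Below it lies omega * T, of size |T| by [j]. *)
have [|u [_ umin]] := @ole_min U2 (fun=> True); first by exists xpredT.
pose x0 : W := (Some (inr u), 0).
have x0P x : olt x x0 <-> exists t n, x = (Some (inl t), n).
  case: x => [[[t|v]|] n]; split => //.
  - by move=> _; exists t, n.
  - by move=> /negP[]; apply/orP; right; apply/andP; split=> //; exact: umin.
  - by move=> [? [? []]].
  - by move=> [? [? []]].
have x0T : seg x0 #= [set: T].
  rewrite card_eq_le; apply/andP; split.
    pose f (x : W) := if x is (Some (inl t), n) then j (t, n) else t0.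
    apply: (card_le_inj (f := f)) => // x y /x0P[t [n ->]] /x0P[t' [n' ->]].
    by move=> /(jI _ _ I I)[-> ->].
  apply: (card_le_inj (f := mk)) => [t _|t t' _ _ [->//]].
  by apply/x0P; exists t, 0.
(* Here [m] is the initial ordinal of size |T| and [l] its successor cardinal, which exists because
   2^T embeds below the top point. *)
have [|m [mT mmin]] := @ole_min W (fun x => seg x #= [set: T]); first by exists x0.
have [|l [lT lmin]] := @ole_min W (fun x => ~ (seg x #<= [set: T])).
  exists (None, 0) => topT; apply: (@not_card_le_pow T t0).
  apply: card_le_trans topT.
  by apply: (card_le_inj (f := fun g => (Some (inr g), 0) : W)) => [//|f g _ _ [->]].
have ltl x : olt x l <-> seg x #<= [set: T].
  split=> [xl|xT].
    by apply: contrapT => /lmin; exact/negP.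
  apply/negP => lx; apply: lT.
  exact: card_le_trans (subset_card_le (seg_sub lx)) xT.
have [mT' Tm] : seg m #<= [set: T] /\ [set: T] #<= seg m.
  by move: mT; rewrite card_eq_le => /andP.
have ml : olt m l by apply/ltl.
have minf : infinite_set (seg m) by apply: infinite_card_eq Tinf; rewrite card_eq_sym.
have cm : is_cardinal_at m.
  move=> y ym; apply/negP => yE; move/negP: ym; apply; apply: mmin.
  exact: card_eq_trans yE mT.
have cl : is_cardinal_at l.
  move=> y yl; apply/negP; rewrite card_eq_le => /andP[_ ly]; apply: lT.
  by apply: card_le_trans ly _; exact/ltl.
have linf : infinite_set (seg l).
  move=> lfin; apply: minf; apply: sub_finite_set lfin.
  exact: seg_sub (oltW ml).
pose M := oseg m.
pose K := oseg l.
pose C (x : M) := `[< is_cardinal_at x /\ infinite_set (seg x) >].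
pose a := osub C.
have aM : is_aleph a M.
  split; first exact: is_cardinal_oseg.
    by apply: infinite_card_eq minf; rewrite card_eq_sym; exact: card_setT_oseg.
  exists sval; split=> //; apply/seteqP; split=> [_ [[x Cx] _ <-]|x Cx].
    exact/asboolP.
  by exists (exist _ x (introT (asboolP _) Cx)).
have aK : is_aleph (osucc a) K.
  split; first exact: is_cardinal_oseg.
    by apply: infinite_card_eq linf; rewrite card_eq_sym; exact: card_setT_oseg.
  (* The new greatest index goes to [m], the only infinite cardinal below [l] that is not below
     [m]. *)
  pose f (i : osucc a) : K :=
    if i is Some x then exist _ (sval (sval x)) (olt_trans (svalP (sval x)) ml)
    else exist _ m ml.
  exists f; split.
    move=> [x|] [y|] //=.
    - exact: oltW (svalP (sval x)).
    - exact: negbTE (svalP (sval y)).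
    - exact: (ole_refl m).
  apply/seteqP; split=> [_ [[[x Cx]|] _ <-]|x [cx xinf]] /=.
  - have [cx xinf] := asboolW Cx; split.
      apply/is_cardinal_at_oseg => /=; exact/is_cardinal_at_oseg.
    by apply: infinite_card_eq xinf; exact: card_seg_oseg_eq.
  - split; first by apply/is_cardinal_at_oseg.
    apply: infinite_card_eq minf; rewrite card_eq_sym.
    exact: (card_seg_oseg (f None)).
  have cx' : is_cardinal_at (sval x) by apply/is_cardinal_at_oseg.
  have [xm|xm|mx] := olt_trich (sval x) m.
  - pose y : M := exist _ (sval x) xm.
    have Cy : C y.
      apply/asboolP; split; first exact/is_cardinal_at_oseg.
      by apply: infinite_card_eq xinf; exact: card_seg_oseg_eq.
    by exists (Some (exist _ y Cy)) => //; exact: val_inj.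
  - by exists None => //; apply: val_inj.
  (* An ordinal strictly between [m] and [l] has the same size as [m], so it is no cardinal. *)
  have /negP[] := cx' _ mx.
  rewrite card_eq_le (subset_card_le (seg_sub (oltW mx))) /=.
  by apply: card_le_trans Tm; apply/ltl; exact: svalP x.
exists K; split.
- move=> x; have := card_seg_oseg x; rewrite card_eq_le => /andP[xx _].
  by apply: card_le_trans xx _; apply/ltl; exact: svalP x.
- apply: card_eq_trans (gch _ _ _ aM aK).
  have MT : [set: M] #= [set: T] := card_eq_trans (card_setT_oseg m) mT.
  have [|y _] := @infinite_setN0 _ [set: M].
    by apply: infinite_card_eq Tinf; rewrite card_eq_sym.
  move: MT; rewrite !card_eq_le => /andP[MT TM].
  apply/andP.
  by split; [exact: card_leT_pow y TM|exact: card_leT_pow t0 MT].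
have mkl t : olt (mk t) l.
  apply/ltl; move: x0T; rewrite card_eq_le => /andP[+ _].
  apply: card_le_trans; apply: subset_card_le; apply: seg_sub.
  by apply/oltW/x0P; exists t, 0.
exists (fun t => exist _ (mk t) (mkl t)); split=> [t t' [//]|t [n nl] [/= nt tmin]].
(* A successor in the segment [K] is one in [W] too, since the points from [l] on exceed every
   mark. *)
apply: (@omegaM_not_succ (osucc (osum U1 U2)) (Some (inl t)) n); split=> // y ny.
have [yl|ly] := boolP (olt y l); first exact: (tmin (exist _ y yl)).
by apply: oltW; apply: olt_ole_trans (mkl t) _; move: ly; rewrite negbK.
Qed.

(** * Counting arguments for an ordinal of size 2^|T| *)

Section PowerOrdinal.
Variables (T : Type) (t : T) (K : ordinalType).
(** The [option] provides tags, so this one bound covers |T| + 1, |T| + |T| and pairs. *)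
Hypothesis optTT : [set: option T * T] #<= [set: T].
Hypothesis segT : forall x : K, seg x #<= [set: T].
Hypothesis powK : [set: T -> bool] #= [set: K].

Let not_card_le : ~ ([set: K] #<= [set: T]).
Proof.
move: powK; rewrite card_eq_le => /andP[powK' _] KT.
exact: not_card_le_pow t (card_le_trans powK' KT).
Qed.

Lemma seg_le_is_cardinal : is_cardinal K.
Proof.
move=> x; apply/negP; rewrite card_eq_le => /andP[_ Kx].
exact/not_card_le/(card_le_trans Kx).
Qed.

(** Otherwise, for [q] above [p] and [n], both the points up to [p] and the [g]-images of the others
    lie below [q], so |K| is at most |T| + |T|. *)
Lemma seg_le_unbounded (g : K -> K) (p n : K) :
  injective g -> exists m, olt p m /\ olt n (g m).
Proof.
move=> gI.
have nomax (x : K) : exists y, olt x y.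
  (* A greatest [x] would bound |K| by |T| + 1. *)
  apply: contrapT => xmax; apply: not_card_le; apply: card_le_trans optTT.
  have [e eI] := (card_leTP _ t).1 (segT x).
  have lex y : olt y x \/ y = x.
    by have [|->|xy] := olt_trich y x; [left|right|case: xmax; exists y].
  pose d y := if olt y x then (None, e y) else (Some t, t).
  apply: (@card_leT_inj _ _ d); rewrite /d.
  move=> y z; have [yx|->] := lex y; have [zx|->] := lex z;
    rewrite ?olt_irr ?yx ?zx //.
  by move=> []; exact: eI.
have [q [pq nq]] : exists q, olt p q /\ olt n q.
  have [pn|np] := orP (ole_total p n).
    by have [q nq] := nomax n; exists q; rewrite (ole_olt_trans pn nq).
  by have [q pq] := nomax p; exists q; rewrite (ole_olt_trans np pq).
apply: contrapT => bounded; apply: not_card_le; apply: card_le_trans optTT.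
have [e eI] := (card_leTP _ t).1 (segT q).
have le_p m : ~~ olt p m -> olt m q.
  by rewrite negbK => mp; exact: ole_olt_trans pq.
have g_le_n m : olt p m -> olt (g m) q.
  move=> pm; apply: ole_olt_trans nq.
  by rewrite -[ole _ _]negbK; apply/negP => ngm; apply: bounded; exists m.
pose d m := if olt p m then (None, e (g m)) else (Some t, e m).
apply: (@card_leT_inj _ _ d); rewrite /d.
move=> x y; case: ifPn => px; case: ifPn => py // [exy].
- by apply/gI/eI => //; exact: g_le_n.
- by apply: eI => //; exact: le_p.
Qed.

Lemma card_ltseq : [set: ltseq K] #= [set: K].
Proof.
move: (powK); rewrite !card_eq_le => /andP[pow_le K_le]; apply/andP; split.
  have [phi phiI] := (card_leTP _ xpredT).1 K_le.
  have /choice[e eI] := fun x : K => (card_leTP _ t).1 (segT x).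
  apply: card_le_trans pow_le.
  apply: (card_le_trans _ (card_leT_pow t optTT)).
  (* Via [phi], elements of [K] are subsets of [T]. The slice of [E s] at [None] stores the length,
     the slice at [Some w] the value at the position that [e] sends to [w]. *)
  pose E (s : ltseq K) (v : option T * T) : bool :=
    if v.1 is Some w then
      `[< exists x y, [/\ lget s x = Some y, e (tag s) x = w & phi y v.2] >]
    else phi (tag s) v.2.
  apply: (@card_leT_inj _ _ E) => s s' /funeqP ss'.
  have tss' : tag s = tag s'.
    apply: (phiI _ _ I I); apply/funext => v; exact: (ss' (None, v)).
  have EE (r : ltseq K) x y v :
      lget r x = Some y -> E r (Some (e (tag r) x), v) = phi y v.
    move=> rx; apply/asboolP/idP => [[x' [y' [rx' ee phiv]]]|phiv]; last first.
      by exists x, y.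
    move: phiv; have xx' : x' = x.
      by apply: eI ee; apply/lget_SomeP; [exists y'|exists y].
    by move: rx'; rewrite xx' rx => -[->].
  apply: lget_inj => // x; have [xs|xs] := pselect (olt x (tag s)).
    have /lget_SomeP[y sx] := xs.
    have /lget_SomeP[y' sx'] : olt x (tag s') by rewrite -tss'.
    rewrite sx sx'; congr Some; apply: (phiI _ _ I I); apply/funext => v.
    by rewrite -(EE _ _ _ _ sx) -(EE _ _ _ _ sx') tss'.
  case sx: (lget s x) => [y|]; first by case: xs; apply/lget_SomeP; exists y.
  case sx': (lget s' x) => [y|//].
  by case: xs; rewrite tss'; apply/lget_SomeP; exists y.
have [x0 _] : [set: K] !=set0.
  apply: contrapT => K0; apply: not_card_le.
  by rewrite (_ : [set: K] = set0) //; apply/eqP/negPn/negP => /set0P.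
(* Conversely, constant sequences of a fixed length p > 0 are told apart by their entry at 0. *)
have [z [_ zmin]] := @ole_min K (fun=> True) (ex_intro _ x0 I).
have [p [zp _]] := @seg_le_unbounded id z z (@inj_id K).
apply: (@card_leT_inj _ _ (fun x => restr (fun=> x) p)) => x y.
move=> /(congr1 (@lget K ^~ z)).
by rewrite !lget_restr zp => -[].
Qed.

End PowerOrdinal.

(** * The theorem, from the sequences in A *)

Theorem theorem5p1 :
  GCH ->
  forall A : partialApp, is_pca A ->
  exists K : ordinalType,
    [/\ is_cardinal K, infinite_set [set: K], [set: ltseq K] #= [set: K] &
        forall code : ltseq K -> K, bijective code ->
        exists f : A -> K2 code, weak_embedding f].
Proof.
move=> gch A [[a [b ab]] _].
pose T := nat -> A; pose t : T := fun=> a.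
have natT : [set: nat] #<= [set: T].
  apply: (@card_leT_inj _ _ (fun n i => if i == n then a else b)) => n k.
  move=> /funeqP/(_ n).
  by rewrite eqxx; case: eqP.
(* Two sequences are interleaved into one. *)
have TT : [set: T * T] #<= [set: T].
  pose merge (fg : T * T) i := if odd i then fg.1 i./2 else fg.2 i./2.
  apply: (@card_leT_inj _ _ merge); rewrite /merge.
  move=> [f g] [f' g'] /funeqP /= fg; congr pair; apply/funext => i.
    by have := fg i.*2.+1; rewrite /= odd_double uphalf_double.
  by have := fg i.*2; rewrite odd_double doubleK.
have [j jI] := (card_leTP _ t).1 TT.
have optTT : [set: option T * T] #<= [set: T].
  (* [Some v] goes to the diagonal and [None] off it, since [a] and [b] differ. *)
  pose o (x : option T) := if x is Some v then (v, v) else (t, (fun=> b) : T).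
  have oI : injective o.
    have tb : t <> (fun=> b) by move=> /(congr1 (@^~ 0)).
    by move=> [v|] [w|] //= [] => [->|-> /tb|<- /esym/tb].
  apply: (@card_leT_inj _ _ (fun v => j (j (o v.1), v.2))) => -[u v] [u' v'].
  by move=> /(jI _ _ I I)[/(jI _ _ I I)/oI -> ->].
have Tnat : [set: T * nat] #<= [set: T].
  have [i iI] := (card_leTP _ t).1 natT.
  apply: (@card_leT_inj _ _ (fun v => j (v.1, i v.2))) => -[f n] [g k].
  by move=> /(jI _ _ I I)[-> /(iI _ _ I I) ->].
have Tinf : infinite_set [set: T].
  by move=> Tfin; apply: infinite_nat; exact: card_le_finite natT Tfin.
have [K [segT powK [mark [markI mark_not_succ]]]] := GCH_ex_cardinal t gch Tinf Tnat.
exists K; split.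
- exact: (seg_le_is_cardinal t segT powK).
- by move=> Kfin; apply: Tinf; exact: card_le_finite (card_leT_inj markI) Kfin.
- exact: (card_ltseq t optTT).
move=> code codeB.
(* Elements of [A] are marked through their constant sequences. *)
apply: (@ex_weak_embedding_K2 _ _ _ (fun d => mark (fun=> d))) (mark t) => //.
- by move=> d d' /markI /(congr1 (@^~ 0)).
- by move=> g gI p n; exact: (seg_le_unbounded t optTT segT powK).
Qed.
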